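(* Let $H$ be a connected (Lie) subgroup of $I^o(\mathbb{L}^2)$ acting on $\mathbb{L}^2$ with cohomogeneity one. Then the action of $H$ is orbit-equivalent to the action of $\mathbb{R}^1$, $\mathbb{L}^1$, $\mathbb{W}^1$ or $SO^o_{1,1}$.
   Context: $\mathbb{L}^2$ is the Minkowski plane $\mathbb{R}^2$ with standard basis $e_1,e_2$ and inner product $\langle u,v\rangle = u_1v_1-u_2v_2$. $I(\mathbb{L}^2) = O_{1,1}\ltimes\mathbb{L}^2$ is its isometry group, with $(x,u)$ acting by $p\mapsto xp+u$; its identity component is $I^o(\mathbb{L}^2) = SO^o_{1,1}\ltimes\mathbb{L}^2$, where $SO^o_{1,1}$ is the identity component of $O_{1,1}$, acting linearly on $\mathbb{L}^2$. The lines $\mathbb{R}^1 = \mathbb{R}e_1$, $\mathbb{L}^1 = \mathbb{R}e_2$ and $\mathbb{W}^1 = \mathbb{R}(e_1-e_2)$ are regarded as one-dimensional groups of translations. An action is of cohomogeneity one if the minimal codimension of its orbits is one. Two isometric actions on $\mathbb{L}^2$ are orbit-equivalent if there is an isometry of $\mathbb{L}^2$ mapping the orbits of one action onto the orbits of the other. *)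

(* Defs.v *)
From HB Require Import structures.
From mathcomp Require Import all_boot all_order all_algebra.
From mathcomp Require Import all_classical all_reals all_analysis.
Set Implicit Arguments.
Unset Strict Implicit.
Unset Printing Implicit Defensive.
Import Order.TTheory GRing.Theory Num.Theory.
Import numFieldNormedType.Exports.
Local Open Scope classical_set_scope.
Local Open Scope ring_scope.

(** * The Minkowski plane and its isometry group *)

Section Minkowski.
Variable R : realType.

Definition e1 : 'cV[R]_2 := delta_mx 0 0.
Definition e2 : 'cV[R]_2 := delta_mx 1 0.

Definition mink (u v : 'cV[R]_2) : R := u 0 0 * v 0 0 - u 1 0 * v 1 0.

Definition O11 : set 'M[R]_2 :=
  [set x | forall u v, mink (x *m u) (x *m v) = mink u v].

Definition SO11o : set 'M[R]_2 := connected_component O11 1%:M.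

(* A pair (x, u) stands for the affine map p |-> x p + u; the isometries are
   the pairs with x in O11, and they inherit topology and smooth structure from
   the ambient normed space of pairs, in which they are embedded. *)
Definition isom_mul (g h : 'M[R]_2 * 'cV[R]_2) : 'M[R]_2 * 'cV[R]_2 :=
  (g.1 *m h.1, g.1 *m h.2 + g.2).
Definition isom_one : 'M[R]_2 * 'cV[R]_2 := (1%:M, 0).
Definition isom_inv (g : 'M[R]_2 * 'cV[R]_2) : 'M[R]_2 * 'cV[R]_2 :=
  (invmx g.1, - (invmx g.1 *m g.2)).
Definition act (g : 'M[R]_2 * 'cV[R]_2) (p : 'cV[R]_2) : 'cV[R]_2 :=
  g.1 *m p + g.2.

Definition isomL2 : set ('M[R]_2 * 'cV[R]_2) := [set g | O11 g.1].
Definition isomL2o : set ('M[R]_2 * 'cV[R]_2) := [set g | SO11o g.1].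

Definition is_subgroup (H : set ('M[R]_2 * 'cV[R]_2)) : Prop :=
  [/\ H isom_one,
      forall g h, H g -> H h -> H (isom_mul g h) &
      forall g, H g -> H (isom_inv g)].

Definition translation_line (v : 'cV[R]_2) : set ('M[R]_2 * 'cV[R]_2) :=
  [set g | exists t : R, g = (1%:M, t *: v)].

Definition boosts : set ('M[R]_2 * 'cV[R]_2) :=
  [set g | SO11o g.1 /\ g.2 = 0].

Definition orbit_of (H : set ('M[R]_2 * 'cV[R]_2)) (p : 'cV[R]_2) :
    set 'cV[R]_2 :=
  [set act g p | g in H].

Definition orbits (H : set ('M[R]_2 * 'cV[R]_2)) : set (set 'cV[R]_2) :=
  range (orbit_of H).

Definition orbit_equivalent (H K : set ('M[R]_2 * 'cV[R]_2)) : Prop :=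
  exists2 f, isomL2 f & [set act f @` O | O in orbits H] = orbits K.

End Minkowski.

(** * Smooth maps *)

(* Meant for finite-dimensional E and open W, where for k >= 1 it is the usual
   k-fold continuous differentiability. *)
Fixpoint Ck (R : realType) (E F : normedModType R) (k : nat) (W : set E)
    (f : E -> F) {struct k} : Prop :=
  match k with
  | 0 => forall x, W x -> {for x, continuous f}
  | k'.+1 => (forall x, W x -> differentiable f x) /\
             (forall v : E, Ck k' W (fun x => 'D_v f x))
  end.

Definition smooth_on (R : realType) (E F : normedModType R) (W : set E)
    (f : E -> F) : Prop := forall k, Ck k W f.

(** * Lie subgroups *)

(* The inverse of a chart: a parametrization, relevant only on [dom]. *)
Record param (R : realType) (d : nat) := Param {
  dom : set 'rV[R]_d;
  par :> 'rV[R]_d -> 'M[R]_2 * 'cV[R]_2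
}.

Section LieSubgroup.
Variables (R : realType) (d : nat).

(* [f], defined on the open set [W], is smooth as a map into the manifold with
   atlas [A]: around each point of [W] it lifts smoothly through some member
   of [A]. *)
Definition smooth_into (E : normedModType R) (A : set (param R d)) (W : set E)
    (f : E -> 'M[R]_2 * 'cV[R]_2) : Prop :=
  forall x, W x -> exists c W' (tau : E -> 'rV[R]_d),
    [/\ A c, open W', W' x, smooth_on W' tau &
        forall y, W' y -> dom c (tau y) /\ c (tau y) = f y].

(* [A] makes [H] a d-dimensional Lie group such that the inclusion of [H] in the
   isometry group is an injective immersion. The manifold topology on [H] is
   the one given by [A], possibly finer than the subspace topology; it is
   automatically Hausdorff, and second countable if connected. Openness of
   the overlaps is part of [lie_compat]. *)
Record lie_subgroup (H : set ('M[R]_2 * 'cV[R]_2)) (A : set (param R d)) :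
    Prop := LieSubgroup {
  lie_group : is_subgroup H;
  lie_cover : H = \bigcup_(c in A) (par c @` dom c);
  lie_open_dom : forall c, A c -> open (dom c);
  lie_inj : forall c, A c -> forall x y, dom c x -> dom c y -> c x = c y ->
    x = y;
  lie_smooth : forall c, A c -> smooth_on (dom c) (par c);
  lie_immersion : forall c, A c -> forall x, dom c x ->
    injective ('d (par c) x : 'rV[R]_d -> 'M[R]_2 * 'cV[R]_2);
  lie_compat : forall c1 c2, A c1 -> A c2 ->
    smooth_into [set c2] (dom c1 `&` par c1 @^-1` (par c2 @` dom c2)) (par c1);
  lie_mul : forall c1 c2, A c1 -> A c2 ->
    smooth_into A (dom c1 `*` dom c2)
      (fun z : 'rV[R]_d * 'rV[R]_d => isom_mul (c1 z.1) (c2 z.2));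
  lie_inv : forall c, A c ->
    smooth_into A (dom c) (fun x => isom_inv (c x))
}.

(* Openness of [B], contained in the manifold, in the topology given by [A]. *)
Definition lie_open (A : set (param R d)) (B : set ('M[R]_2 * 'cV[R]_2)) :
    Prop :=
  forall c, A c -> open (dom c `&` par c @^-1` B).

Definition lie_connected (H : set ('M[R]_2 * 'cV[R]_2)) (A : set (param R d)) :
    Prop :=
  forall B, B `<=` H -> B !=set0 -> lie_open A B -> lie_open A (H `\` B) ->
    B = H.

(* The orbit through p is an immersed submanifold of the plane whose tangent
   space at p is the image of the differential at the identity of the orbit
   map h |-> h p. *)
Definition orbit_tangent (A : set (param R d)) (p : 'cV[R]_2) :
    set 'cV[R]_2 :=
  [set w | exists c x (v : 'rV[R]_d), [/\ A c, dom c x, c x = isom_one R &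
     w = 'd (fun y => act (c y) p) x v]].

Definition orbit_codim (A : set (param R d)) (p : 'cV[R]_2) (k : nat) : Prop :=
  exists2 W : {vspace 'cV[R]_2},
    orbit_tangent A p = [set w | w \in W] & (\dim W + k = 2)%N.

Definition cohomogeneity (A : set (param R d)) (m : nat) : Prop :=
  (exists p, orbit_codim A p m) /\
  (forall p k, orbit_codim A p k -> (m <= k)%N).

End LieSubgroup.

(* Main.v *)
Require Import Defs.
From mathcomp Require Import all_boot all_order all_algebra.
From mathcomp Require Import all_classical all_reals all_analysis.
From mathcomp Require Import ring lra.
Import Order.TTheory GRing.Theory Num.Theory.
Import numFieldNormedType.Exports.
Local Open Scope classical_set_scope.
Local Open Scope ring_scope.

(** Null coordinates p0 + p1 and p0 - p1 diagonalize the identity component of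
    the isometry group: its elements act by (P, Q) |-> (s P + a, Q / s + b)
    with s > 0. The velocity field of a tangent vector of H at the identity is
    therefore (r P + m, - r Q + n), for a triple (r, m, n) attached to that
    tangent vector.

    Cohomogeneity one says that at each point the velocities span a space of
    dimension at most one, and somewhere exactly one. The determinant of two
    velocities is a polynomial in P and Q; its coefficients are the 2 x 2
    minors of the two triples, so all triples are multiples of a single
    nonzero one, [tangent_minors] and [tangent_neq0]. In effect the Lie algebra
    of H is a line.

    Tangent spaces of H at other points are right translates of the one at the
    identity, [right_invariance]. Since all triples are proportional to
    (r, m, n), the functions (r a + m) / s and (r b - n) s have zero derivative
    in every chart, and so does n a - m b when r = 0. By connectedness they are
    constant on H, [lie_connected_const]. These equations cut out a
    one-parameter group containing H: the boosts around the point where the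
    field of (r, m, n) vanishes if r <> 0, the translations along a line if
    r = 0. A parameter of that group, log s in the first case and the position
    on the line in the second, is a nonzero homomorphism from H to the reals,
    continuous for the Lie topology; connectedness makes it surjective,
    [hom_surjective], so H is the whole one-parameter group
    ([line_or_boosts]).

    Finally, a translation moves the centre of the boosts to the origin, and a
    linear isometry takes a direction to a multiple of e1, e2 or e1 - e2,
    according to the sign of its square norm. *)

(** * Null coordinates and boosts *)

Section NullCoordinates.
Set Implicit Arguments.
Unset Strict Implicit.
Context {R : realType}.
Implicit Types (x y : 'M[R]_2) (u v p : 'cV[R]_2) (g h k : 'M[R]_2 * 'cV[R]_2).

Definition nullp u : R := u 0 0 + u 1 0.
Definition nullm u : R := u 0 0 - u 1 0.
(** On a boost, [stretch] and [costretch] are the eigenvalues exp t and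
    exp (- t) on the null directions, t being the rapidity; they
    are given by formulas linear in the entries, hence differentiable along charts. *)
Definition stretch x : R := x 0 0 + x 0 1.
Definition costretch x : R := x 0 0 - x 0 1.

Definition boost_mx x : Prop :=
  [/\ x 1 1 = x 0 0, x 1 0 = x 0 1, 0 < stretch x &
      stretch x * costretch x = 1].

Lemma mulmx2E m n (x : 'M[R]_(m, 2)) (y : 'M[R]_(2, n)) i j :
  (x *m y) i j = x i 0 * y 0 j + x i 1 * y 1 j.
Proof.
rewrite mxE !big_ord_recl big_ord0 addr0.
by congr (_ + x i _ * y _ j); apply: val_inj.
Qed.

Lemma cV2P u v : u 0 0 = v 0 0 -> u 1 0 = v 1 0 -> u = v.
Proof.
move=> h0 h1; apply/colP => i.
by case: (unliftP 0 i) => [j|] -> //;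
  rewrite ord1 (_ : lift 0 0 = 1)//; apply: val_inj.
Qed.

Lemma mx2P x y : x 0 0 = y 0 0 -> x 0 1 = y 0 1 -> x 1 0 = y 1 0 ->
  x 1 1 = y 1 1 -> x = y.
Proof.
have lift1 : lift 0 0 = 1 :> 'I_2 by apply: val_inj.
move=> h00 h01 h10 h11; apply/matrixP => i j.
by case: (unliftP 0 i) => [i'|] ->; case: (unliftP 0 j) => [j'|] ->;
  rewrite ?ord1 ?lift1.
Qed.

Lemma null_inj u v : nullp u = nullp v -> nullm u = nullm v -> u = v.
Proof. by rewrite /nullp /nullm => hp hm; apply: cV2P; lra. Qed.

Lemma null_surj (a b : R) : exists u, nullp u = a /\ nullm u = b.
Proof.
exists (((a + b) / 2) *: e1 R + ((a - b) / 2) *: e2 R).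
by split; rewrite /nullp /nullm !mxE /= !(mulr1, mulr0); field.
Qed.

Lemma boost_mx_inj x y : boost_mx x -> boost_mx y ->
  stretch x = stretch y -> x = y.
Proof.
case=> x11 x10 x0 xx [y11 y10 y0 yy] xy.
have /(mulfI (lt0r_neq0 x0)) cxy :
    stretch x * costretch x = stretch x * costretch y.
  by rewrite xx xy yy.
by move: xy cxy; rewrite /stretch /costretch => h1 h2; apply: mx2P; lra.
Qed.

Lemma boost_mx_eq1 x : boost_mx x -> stretch x = 1 -> x = 1%:M.
Proof.
move=> bx x1; apply: boost_mx_inj => //.
  by split; rewrite /stretch /costretch !mxE /= ?addr0 ?subr0 ?mulr1.
by rewrite x1 /stretch !mxE /= addr0.
Qed.

Lemma stretchM x y : boost_mx y -> stretch (x *m y) = stretch x * stretch y.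
Proof.
by case=> y11 y10 _ _; rewrite /stretch !mulmx2E y11 y10; ring.
Qed.

Lemma costretchM x y : boost_mx y ->
  costretch (x *m y) = costretch x * costretch y.
Proof.
by case=> y11 y10 _ _; rewrite /costretch !mulmx2E y11 y10; ring.
Qed.

Lemma nullp_mul x u : boost_mx x -> nullp (x *m u) = stretch x * nullp u.
Proof.
by case=> x11 x10 _ _; rewrite /stretch /nullp !mulmx2E x11 x10; ring.
Qed.

Lemma nullm_mul x u : boost_mx x -> nullm (x *m u) = costretch x * nullm u.
Proof.
by case=> x11 x10 _ _; rewrite /costretch /nullm !mulmx2E x11 x10; ring.
Qed.

Lemma nullpD u v : nullp (u + v) = nullp u + nullp v.
Proof. by rewrite /nullp !mxE; ring. Qed.

Lemma nullmD u v : nullm (u + v) = nullm u + nullm v.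
Proof. by rewrite /nullm !mxE; ring. Qed.

Lemma nullpZ a u : nullp (a *: u) = a * nullp u.
Proof. by rewrite /nullp !mxE; ring. Qed.

Lemma nullmZ a u : nullm (a *: u) = a * nullm u.
Proof. by rewrite /nullm !mxE; ring. Qed.

Lemma nullp0 : nullp 0 = 0.
Proof. by rewrite /nullp !mxE; ring. Qed.

Lemma nullm0 : nullm 0 = 0.
Proof. by rewrite /nullm !mxE; ring. Qed.

(** Comparing the coefficients of 1, a and b is enough. *)
Lemma affine_minors (r m n r' m' n' : R) :
  (forall a b, (r * a + m) * (- r' * b + n') = (r' * a + m') * (- r * b + n)) ->
  [/\ r * m' = r' * m, r * n' = r' * n & m * n' = m' * n].
Proof.
move=> minor.
have m00 := minor 0 0; have m10 := minor 1 0; have m01 := minor 0 1.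
by split; lra.
Qed.

Lemma O11P x : O11 x <-> [/\ x 0 0 ^+ 2 - x 1 0 ^+ 2 = 1,
  x 0 1 ^+ 2 - x 1 1 ^+ 2 = -1 & x 0 0 * x 0 1 - x 1 0 * x 1 1 = 0].
Proof.
split=> [xO|[x0 x1 x01] u v]; last first.
  rewrite /mink !mulmx2E.
  transitivity ((x 0 0 ^+ 2 - x 1 0 ^+ 2) * (u 0 0 * v 0 0) +
    (x 0 1 ^+ 2 - x 1 1 ^+ 2) * (u 1 0 * v 1 0) +
    (x 0 0 * x 0 1 - x 1 0 * x 1 1) * (u 0 0 * v 1 0 + u 1 0 * v 0 0)).
    by ring.
  by rewrite x0 x1 x01; ring.
have h00 := xO (e1 R) (e1 R); have h11 := xO (e2 R) (e2 R).
have h01 := xO (e1 R) (e2 R).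
move: h00 h11 h01; rewrite /mink !mulmx2E !mxE /= => h00 h11 h01.
by split; lra.
Qed.

Lemma O11_unitmx x : O11 x -> x \in unitmx.
Proof.
move=> /O11P[m0 m1 m01].
have : (\matrix_(i, j) ((-1) ^+ (i + j) * x j i)) *m x = 1%:M.
  apply: mx2P; rewrite mulmx2E !mxE /= ?expr0 ?expr1 ?sqrrN ?expr1n; lra.
by case/mulmx1_unit.
Qed.

Lemma isom_mulK g k : k.1 \in unitmx ->
  isom_mul (isom_mul g (isom_inv k)) k = g.
Proof.
move=> ku.
case: g => g1 g2; rewrite /isom_mul /isom_inv /=; congr pair.
  by rewrite -mulmxA mulVmx// mulmx1.
by rewrite mulmxN -!mulmxA addrA subrr add0r.
Qed.

Lemma isom_mulV k : k.1 \in unitmx -> isom_mul k (isom_inv k) = isom_one R.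
Proof.
move=> ku.
by rewrite /isom_mul /isom_inv /isom_one /= mulmxV// mulmxN mulKVmx// addNr.
Qed.

Lemma isom_mul1 g : isom_mul (isom_one R) g = g.
Proof. by case: g => x u; rewrite /isom_mul /= !mul1mx addr0. Qed.

Lemma dim_le1_minor (W : {vspace 'cV[R]_2}) u v : (\dim W <= 1)%N ->
  u \in W -> v \in W -> nullp u * nullm v = nullp v * nullm u.
Proof.
move=> dW uW vW; have [->|u0] := eqVneq u 0.
  by rewrite nullp0 nullm0; ring.
have /eqP WE : (<[u]> == W)%VS by rewrite eqEdim -memvE uW dim_vline u0.
move: vW; rewrite -WE => /vlineP[k ->].
by rewrite nullpZ nullmZ; ring.
Qed.

(** A continuous function without zeros keeps its sign on a connected set. *)
Lemma coord_sgn (C : set 'M[R]_2) (i j : 'I_2) : connected C ->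
  C 1%:M -> (1%:M : 'M[R]_2) i j = 1 -> (forall x, C x -> x i j != 0) ->
  forall x, C x -> 0 < x i j.
Proof.
move=> cC C1 ij1 Cn0 x Cx; rewrite ltNge; apply/negP => xle0.
have : connected ((fun y : 'M[R]_2 => y i j) @` C).
  apply: connected_continuous_connected => //.
  exact/continuous_subspaceT/coord_continuous.
move/connected_intervalP => /(_ (x i j) 1 _ _ 0) [||| y Cy /eqP].
- by exists x.
- by exists 1%:M.
- by rewrite xle0 ler01.
- by rewrite (negbTE (Cn0 y Cy)).
Qed.

(** The diagonal entries of an element of [O11] have absolute value at least 1,
    so they stay positive on the component of the identity; orthogonality of the
    columns then leaves no freedom but the rapidity. *)
Lemma SO11o_boost_mx x : SO11o x -> boost_mx x.
Proof.
move=> Cx.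
have cC : connected (@SO11o R) by exact: component_connected.
have sC : @SO11o R `<=` @O11 R by exact: connected_component_sub.
have C1 : @SO11o R 1%:M.
  by apply: connected_component_refl => u v; rewrite !mul1mx.
have x00 : 0 < x 0 0.
  apply: (coord_sgn cC C1 _ _ Cx); first by rewrite mxE.
  move=> y /sC /O11P[y0 _ _]; apply/eqP => y00.
  by have := sqr_ge0 (y 1 0); rewrite y00 in y0; nra.
have x11 : 0 < x 1 1.
  apply: (coord_sgn cC C1 _ _ Cx); first by rewrite mxE.
  move=> y /sC /O11P[_ y1 _]; apply/eqP => y11.
  by have := sqr_ge0 (y 0 1); rewrite y11 in y1; nra.
have /sC /O11P[h0 h1 h01] := Cx.
(* The norms of the columns, put into the square of their orthogonality
   relation, leave an equation between the diagonal entries. *)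
have sq_diff : (x 0 0 - x 1 1) * (x 0 0 + x 1 1) = 0.
  have e : x 0 0 ^+ 2 * x 0 1 ^+ 2 = x 1 0 ^+ 2 * x 1 1 ^+ 2.
    by rewrite -!exprMn; congr (_ ^+ 2); lra.
  have c2 : x 0 1 ^+ 2 = x 1 1 ^+ 2 - 1 by lra.
  have b2 : x 1 0 ^+ 2 = x 0 0 ^+ 2 - 1 by lra.
  rewrite c2 b2 in e; lra.
have e11 : x 1 1 = x 0 0.
  by move/eqP: sq_diff; rewrite mulf_eq0 => /orP[]/eqP; lra.
have e10 : x 1 0 = x 0 1.
  apply: (mulfI (lt0r_neq0 x00)); rewrite e11 in h01; lra.
have stretchK : stretch x * costretch x = 1.
  by rewrite /stretch /costretch -h0 e10; ring.
split=> //; rewrite /stretch /costretch in stretchK *; nra.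
Qed.

End NullCoordinates.

(** * Derivatives in normed modules *)

Section Calculus.
Set Implicit Arguments.
Unset Strict Implicit.
Context {R : realType}.

Lemma comp_is_derive (E F U : normedModType R) (t : E -> F) (g : F -> U) x v :
  differentiable t x -> differentiable g (t x) ->
  is_derive x v (g \o t) ('D_('D_v t x) g (t x)).
Proof.
move=> dt dg.
have dgt : differentiable (g \o t) x by exact: differentiable_comp.
by apply: DeriveDef; [exact: diff_derivable|rewrite !deriveE// diff_comp].
Qed.

(** A form of the chain rule for functions that factor only locally, as chart
    changes do. *)
Lemma chain_is_derive (E F U : normedModType R) (f : E -> U) (t : E -> F)
    (g : F -> U) x v :
  differentiable t x -> differentiable g (t x) ->
  (\near x, g (t x) = f x) -> is_derive x v f ('D_('D_v t x) g (t x)).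
Proof.
by move=> dt dg gf; apply: near_eq_is_derive gf _; exact: comp_is_derive.
Qed.

(** On a segment inside a ball this is the mean value theorem. *)
Lemma near_const (E : normedModType R) (f : E -> R) (D : set E) x :
  open D -> D x ->
  (forall y, D y -> differentiable f y /\ forall v, 'D_v f y = 0) ->
  \forall y \near x, f y = f x.
Proof.
move=> oD Dx df; have /nbhs_ballP[e /= e0 De] := open_nbhs_nbhs (conj oD Dx).
apply/nbhs_ballP; exists e => //= y xy.
pose g (t : R) := f (t *: (y - x) + x).
have seg (t : R) : t \in `[0, 1]%R -> D (t *: (y - x) + x).
  rewrite in_itv/= => /andP[t0 t1]; apply: De.
  move: xy; rewrite -!ball_normE /= -normrN opprB => xy.
  rewrite opprD addrCA subrr addr0 normrN normrZ ger0_norm//.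
  by apply: le_lt_trans xy; rewrite ler_piMl.
have dg (t : R) : t \in `[0, 1]%R -> is_derive t 1 g 0.
  move=> /seg /df[dft ft0].
  have -> : (0 : R) = 'D_('D_1 (fun t : R => t *: (y - x) + x) t) f
                (t *: (y - x) + x) by rewrite ft0.
  have dl : differentiable (fun t : R => t *: (y - x) + x) t by [].
  exact: (comp_is_derive (1 : R) dl dft).
have dg' (t : R) : t \in `]0, 1[%R -> is_derive t 1 g 0.
  rewrite in_itv/= => /andP[/ltW t0 /ltW t1]; apply: dg.
  by rewrite in_itv/= t0.
have cg : {within `[0, 1], continuous g}.
  apply: derivable_within_continuous => t t01.
  by case: (dg t t01).
have [z _] := MVT_segment ler01 dg' cg.
rewrite mul0r /g scale1r scale0r add0r subrK => /eqP.
by rewrite subr_eq0 => /eqP.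
Qed.

Lemma is_derive_affine (E : normedModType R) (f g : E -> R) (a : R) x v df dg :
  is_derive x v f df -> is_derive x v g dg ->
  is_derive x v (fun y => f y * a + g y) (df * a + dg).
Proof.
move=> Df Dg.
have D := is_deriveD (is_deriveM Df (is_derive_cst a x v)) Dg.
by apply: (is_derive_eq D); rewrite /= scaler0 add0r [a *: _]mulrC.
Qed.

Lemma is_derive_affineM (E : normedModType R) (f g : E -> R) (a b : R) x v
    df dg :
  is_derive x v f df -> is_derive x v g dg ->
  is_derive x v (fun y => (a * f y + b) * g y)
    (a * df * g x + (a * f x + b) * dg).
Proof.
move=> Df Dg.
have D := is_deriveM (is_derive_affine a Df (is_derive_cst b x v)) Dg.
have -> : (fun y => (a * f y + b) * g y) =
    ((fun y => f y * a + cst b y) * g : E -> R).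
  by apply/funext => y; rewrite fctE [a * f y]mulrC.
by apply: (is_derive_eq D); rewrite /GRing.scale /=; ring.
Qed.

End Calculus.

(** * Smoothness of the coordinates of an isometry *)

Section Smoothness.
Set Implicit Arguments.
Unset Strict Implicit.
Context {R : realType}.
Implicit Types (g k : 'M[R]_2 * 'cV[R]_2) (p : 'cV[R]_2).

Lemma differentiable_linpart g :
  differentiable (fun k : 'M[R]_2 * 'cV[R]_2 => k.1) g.
Proof.
have c : continuous (fst : 'M[R]_2 * 'cV[R]_2 -> 'M[R]_2).
  by move=> z; exact: cvg_fst.
exact: (@linear_differentiable R ('M[R]_2 * 'cV[R]_2)%type 'M[R]_2 fst g c).
Qed.

Lemma differentiable_transpart g :
  differentiable (fun k : 'M[R]_2 * 'cV[R]_2 => k.2) g.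
Proof.
have c : continuous (snd : 'M[R]_2 * 'cV[R]_2 -> 'cV[R]_2).
  by move=> z; exact: cvg_snd.
exact: (@linear_differentiable R ('M[R]_2 * 'cV[R]_2)%type 'cV[R]_2 snd g c).
Qed.

Lemma differentiable_lincoord i j g :
  differentiable (fun k : 'M[R]_2 * 'cV[R]_2 => k.1 i j : R) g.
Proof.
have dc := @differentiable_coord R _ _ g.1 i j.
exact: (differentiable_comp (differentiable_linpart g) dc).
Qed.

Lemma differentiable_transcoord i j g :
  differentiable (fun k : 'M[R]_2 * 'cV[R]_2 => k.2 i j : R) g.
Proof.
have dc := @differentiable_coord R _ _ g.2 i j.
exact: (differentiable_comp (differentiable_transpart g) dc).
Qed.

Lemma differentiable_stretch g :
  differentiable (fun k : 'M[R]_2 * 'cV[R]_2 => stretch k.1) g.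
Proof.
exact: (differentiableD (differentiable_lincoord 0 0 g)
  (differentiable_lincoord 0 1 g)).
Qed.

Lemma differentiable_costretch g :
  differentiable (fun k : 'M[R]_2 * 'cV[R]_2 => costretch k.1) g.
Proof.
exact: (differentiableB (differentiable_lincoord 0 0 g)
  (differentiable_lincoord 0 1 g)).
Qed.

Lemma differentiable_nullp g :
  differentiable (fun k : 'M[R]_2 * 'cV[R]_2 => nullp k.2) g.
Proof.
exact: (differentiableD (differentiable_transcoord 0 0 g)
  (differentiable_transcoord 1 0 g)).
Qed.

Lemma differentiable_nullm g :
  differentiable (fun k : 'M[R]_2 * 'cV[R]_2 => nullm k.2) g.
Proof.
exact: (differentiableB (differentiable_transcoord 0 0 g)
  (differentiable_transcoord 1 0 g)).
Qed.

Lemma differentiable_act p g : differentiable (fun k => act k p) g.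
Proof.
have c (a : R) := @differentiable_cst R ('M[R]_2 * 'cV[R]_2)%type R a g.
have row i : differentiable (fun k : 'M[R]_2 * 'cV[R]_2 =>
    k.1 i 0 * p 0 0 + k.1 i 1 * p 1 0) g.
  exact: (differentiableD
    (differentiableM (differentiable_lincoord i 0 g) (c (p 0 0)))
    (differentiableM (differentiable_lincoord i 1 g) (c (p 1 0)))).
have := differentiableD (differentiableD
  (differentiableZl (e1 R) (row 0)) (differentiableZl (e2 R) (row 1)))
  (differentiable_transpart g).
congr (differentiable _ _); apply/funext => k.
apply: cV2P; rewrite !fctE /act /e1 /e2 !(mulmx2E, mxE) ?mxE /=; ring.
Qed.

End Smoothness.

(** * Connected subgroups of cohomogeneity one *)

Section LieSubgroups.
Set Implicit Arguments.
Unset Strict Implicit.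
Context {R : realType} {d : nat}.
Variables (H : set ('M[R]_2 * 'cV[R]_2)) (A : set (param R d)).
Hypothesis lieH : lie_subgroup H A.
Hypothesis connH : lie_connected H A.
Hypothesis HG : H `<=` @isomL2o R.
Implicit Types (c : param R d) (x : 'rV[R]_d) (g h : 'M[R]_2 * 'cV[R]_2).

Lemma mem_boost_mx g : H g -> boost_mx g.1.
Proof. by move=> /HG; exact: SO11o_boost_mx. Qed.

Lemma mem_unitmx g : H g -> g.1 \in unitmx.
Proof. by move=> /HG/connected_component_sub; exact: O11_unitmx. Qed.

Lemma chart_mem c x : A c -> dom c x -> H (c x).
Proof. by move=> Ac cx; rewrite (lie_cover lieH); exists c => //; exists x. Qed.

Lemma chart_at g : H g -> exists c x, [/\ A c, dom c x & c x = g].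
Proof. by rewrite {1}(lie_cover lieH) => -[c Ac [x cx <-]]; exists c, x. Qed.

Lemma chart_differentiable c x : A c -> dom c x -> differentiable c x.
Proof. by move=> Ac cx; have [/(_ x cx)] := lie_smooth lieH Ac 1. Qed.

Lemma near_dom c x : A c -> dom c x -> \forall y \near x, dom c y.
Proof.
by move=> Ac cx; exact: (open_nbhs_nbhs (conj (lie_open_dom lieH Ac) cx)).
Qed.

(** Injectivity of [c2] pins the lift of [c1] at the base point. *)
Lemma transition c1 c2 x1 x2 : A c1 -> A c2 -> dom c1 x1 -> dom c2 x2 ->
  c1 x1 = c2 x2 ->
  exists t : 'rV[R]_d -> 'rV[R]_d, [/\ differentiable t x1, t x1 = x2 &
    \forall y \near x1, dom c2 (t y) /\ c2 (t y) = c1 y].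
Proof.
move=> A1 A2 d1 d2 e12.
have [|c [W [t [-> oW Wx st lift]]]] := lie_compat lieH A1 A2 (x := x1).
  by split=> //; exists x2.
have [dt _] := st 1.
exists t; split; first exact: dt.
  by have [dtx etx] := lift _ Wx; apply: (lie_inj lieH A2) => //; rewrite etx.
exact: filterS lift (open_nbhs_nbhs (conj oW Wx)).
Qed.

Variables (c0 : param R d) (x0 : 'rV[R]_d).
Hypotheses (A0 : A c0) (d0 : dom c0 x0) (c01 : c0 x0 = isom_one R).

(** Near x, the map y |-> c y (c x)^-1 takes values near the identity, and
    smoothness of the multiplication lifts it to the chart [c0]. *)
Lemma right_translation c x : A c -> dom c x ->
  exists t : 'rV[R]_d -> 'rV[R]_d, [/\ differentiable t x, t x = x0 &
    \forall y \near x, dom c0 (t y) /\ isom_mul (c0 (t y)) (c x) = c y].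
Proof.
move=> Ac dx; have Hg := chart_mem Ac dx.
have [_ _ inv] := lie_group lieH.
have [c2 [x2 [A2 d2 e2]]] := chart_at (inv _ Hg).
have [|c3 [W [t [A3 oW Wx st lift]]]] := lie_mul lieH Ac A2 (x := (x, x2)).
  by split.
have [d3 e3] := lift _ Wx.
have [|t' [dt' et' near_t']] := transition A3 A0 d3 d0.
  by rewrite e3 /= e2 c01 isom_mulV//; exact: mem_unitmx.
have [/(_ _ Wx) dt _] := st 1.
pose j (y : 'rV[R]_d) := (y, x2).
have dj : differentiable j x.
  exact: (@differentiable_pair R _ _ _ (fun y => y) (cst x2)).
exists (t' \o (t \o j)); split => //.
  by apply: differentiable_comp => //; exact: differentiable_comp.
have cj : {for x, continuous j} := differentiable_continuous dj.
have ct : {for j x, continuous t} := differentiable_continuous dt.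
have near_W : \forall y \near x, W (j y).
  exact: (cj _ (open_nbhs_nbhs (conj oW Wx))).
have near_c0 : \forall y \near x,
    dom c0 (t' (t (j y))) /\ c0 (t' (t (j y))) = c3 (t (j y)).
  exact: (continuous_comp cj ct near_t').
apply: filterS2 near_W near_c0 => y /lift[_ e4] /= [d4 ->].
split=> //; rewrite e4 /= e2 isom_mulK//; exact: mem_unitmx.
Qed.


Lemma chart_coord_differentiable (f : 'M[R]_2 * 'cV[R]_2 -> R) c x :
  (forall g, differentiable f g) -> A c -> dom c x ->
  differentiable (fun y => f (c y)) x.
Proof.
move=> df Ac dx.
exact: (differentiable_comp (chart_differentiable Ac dx) (df (c x))).
Qed.

Lemma chart_coord_is_derive (f : 'M[R]_2 * 'cV[R]_2 -> R) c x v :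
  (forall g, differentiable f g) -> A c -> dom c x ->
  is_derive x v (fun y => f (c y)) ('D_v (fun y => f (c y)) x).
Proof.
move=> df Ac dx; apply/derivableP/diff_derivable.
exact: chart_coord_differentiable.
Qed.

(** Differentiate stretch * costretch = 1. *)
Lemma costretch_is_derive c x v : A c -> dom c x ->
  'D_v (fun y => costretch (c y).1) x * stretch (c x).1 =
    - ('D_v (fun y => stretch (c y).1) x * costretch (c x).1).
Proof.
move=> Ac dx.
have dr := chart_coord_is_derive v (@differentiable_stretch R) Ac dx.
have dc := chart_coord_is_derive v (@differentiable_costretch R) Ac dx.
have := @derive_val _ _ _ _ _ _ _ (is_deriveM dr dc).
have -> :
    'D_v ((fun y => stretch (c y).1) * (fun y => costretch (c y).1)) x = 0.
  rewrite -[RHS](derive_cst (1 : R) x v); apply: near_eq_derive.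
  apply: filterS (near_dom Ac dx) => y dy.
  by have [_ _ _] := mem_boost_mx (chart_mem Ac dy).
rewrite /GRing.scale /= => /esym/eqP.
by rewrite addr_eq0 mulrC => /eqP ->; rewrite mulrC.
Qed.

(** The triple (r, m, n) of the tangent vector at the identity which has
    coordinates v in the chart [c0]. *)
Let stretch' v : R := 'D_v (fun y => stretch (c0 y).1) x0.
Let nullp' v : R := 'D_v (fun y => nullp (c0 y).2) x0.
Let nullm' v : R := 'D_v (fun y => nullm (c0 y).2) x0.

Lemma costretch'E v : 'D_v (fun y => costretch (c0 y).1) x0 = - stretch' v.
Proof.
have := costretch_is_derive v A0 d0.
by rewrite c01 /stretch /costretch !mxE /= addr0 subr0 !mulr1.
Qed.

(** The tangent space of H at g = c x is the right translate by g of the tangent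
    space at the identity: the coordinates of k g are affine functions of those
    of k, with coefficients the coordinates of g. *)
Lemma right_invariance c x v : A c -> dom c x -> exists w,
  [/\ 'D_v (fun y => stretch (c y).1) x = stretch' w * stretch (c x).1,
      'D_v (fun y => costretch (c y).1) x = - stretch' w * costretch (c x).1,
      'D_v (fun y => nullp (c y).2) x = stretch' w * nullp (c x).2 + nullp' w &
      'D_v (fun y => nullm (c y).2) x = - stretch' w * nullm (c x).2 + nullm' w].
Proof.
move=> Ac dx; have [t [dt tx near_t]] := right_translation Ac dx.
have bx := mem_boost_mx (chart_mem Ac dx).
exists ('D_v t x).
have chain (f g h : 'M[R]_2 * 'cV[R]_2 -> R) (a : R) :
    (forall k, differentiable f k) -> (forall k, differentiable h k) ->
    (forall k, H k -> g (isom_mul k (c x)) = f k * a + h k) ->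
    'D_v (fun y => g (c y)) x =
    'D_('D_v t x) (fun y => f (c0 y)) x0 * a +
    'D_('D_v t x) (fun y => h (c0 y)) x0.
  move=> df dh gfh.
  have df0 := chart_coord_differentiable df A0 d0.
  have dh0 := chart_coord_differentiable dh A0 d0.
  have D w := is_derive_affine a (chart_coord_is_derive w df A0 d0)
    (chart_coord_is_derive w dh A0 d0).
  pose G y := f (c0 y) * a + h (c0 y).
  have dG : differentiable G (t x).
    rewrite tx.
    exact: (differentiableD (differentiableM df0 (differentiable_cst a x0)) dh0).
  have near_G : \forall y \near x, G (t y) = g (c y).
    apply: filterS near_t => y [dty <-].
    by rewrite gfh//; exact: chart_mem.
  rewrite (@derive_val _ _ _ _ _ _ _ (chain_is_derive v dt dG near_G)) tx.
  exact: (@derive_val _ _ _ _ _ _ _ (D _)).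
have d0cst k : differentiable (cst 0 : 'M[R]_2 * 'cV[R]_2 -> R) k by [].
have D0cst w : 'D_w (fun y : 'rV[R]_d => (cst 0 : _ -> R) (c0 y)) x0 = 0.
  exact: derive_cst.
split.
- rewrite (chain (fun k => stretch k.1) (fun k => stretch k.1) (cst 0)
    (stretch (c x).1)) ?D0cst ?addr0//.
  + exact: differentiable_stretch.
  + by move=> k Hk; rewrite addr0 stretchM.
- rewrite (chain (fun k => costretch k.1) (fun k => costretch k.1) (cst 0)
    (costretch (c x).1)) ?D0cst ?addr0.
  + by rewrite costretch'E.
  + exact: differentiable_costretch.
  + by [].
  + by move=> k Hk; rewrite addr0 costretchM.
- apply: (chain (fun k => stretch k.1) (fun k => nullp k.2)
    (fun k => nullp k.2) (nullp (c x).2)).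
  + exact: differentiable_stretch.
  + exact: differentiable_nullp.
  + by move=> k Hk; rewrite nullpD nullp_mul//; exact: mem_boost_mx.
- rewrite -costretch'E.
  apply: (chain (fun k => costretch k.1) (fun k => nullm k.2)
    (fun k => nullm k.2) (nullm (c x).2)).
  + exact: differentiable_costretch.
  + exact: differentiable_nullm.
  + by move=> k Hk; rewrite nullmD nullm_mul//; exact: mem_boost_mx.
Qed.


Let orbit_map p (y : 'rV[R]_d) := act (c0 y) p.

Lemma orbit_map_differentiable p c x : A c -> dom c x ->
  differentiable (fun y => act (c y) p) x.
Proof.
move=> Ac dx.
exact: (differentiable_comp (chart_differentiable Ac dx)
  (differentiable_act p (c x))).
Qed.

(** The boost part contributes a linear field with eigenvalues r and - r along
    the null directions, the translation part a constant. *)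
Lemma orbit_velocity p v :
  nullp ('D_v (orbit_map p) x0) = stretch' v * nullp p + nullp' v /\
  nullm ('D_v (orbit_map p) x0) = - stretch' v * nullm p + nullm' v.
Proof.
have dm := diff_derivable (v := v) (orbit_map_differentiable p A0 d0).
have dm0 := (derivable_mxP _ _ _).1 dm 0 0.
have dm1 := (derivable_mxP _ _ _).1 dm 1 0.
have D f := @chart_coord_is_derive f c0 x0 v.
split.
- rewrite /nullp (derive_mx dm) !mxE -(deriveD dm0 dm1).
  have Da := is_derive_affine (nullp p) (D _ (@differentiable_stretch R) A0 d0)
    (D _ (@differentiable_nullp R) A0 d0).
  rewrite -(@derive_val _ _ _ _ _ _ _ Da); apply: near_eq_derive.
  apply: filterS (near_dom A0 d0) => y dy.
  rewrite -nullp_mul; last exact: mem_boost_mx (chart_mem A0 dy).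
  by rewrite -nullpD.
- rewrite /nullm (derive_mx dm) !mxE -(deriveB dm0 dm1).
  have Da := is_derive_affine (nullm p) (D _ (@differentiable_costretch R) A0 d0)
    (D _ (@differentiable_nullm R) A0 d0).
  rewrite -costretch'E -(@derive_val _ _ _ _ _ _ _ Da); apply: near_eq_derive.
  apply: filterS (near_dom A0 d0) => y dy.
  rewrite -nullm_mul; last exact: mem_boost_mx (chart_mem A0 dy).
  by rewrite -nullmD.
Qed.

Let orbit_tangent_space p : {vspace 'cV[R]_2} :=
  limg (linfun ('d (orbit_map p) x0 : 'rV[R]_d -> 'cV[R]_2)).

Lemma mem_orbit_tangent_space p u :
  u \in orbit_tangent_space p <-> exists v, u = 'D_v (orbit_map p) x0.
Proof.
have dm := orbit_map_differentiable p A0 d0.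
split=> [/memv_imgP[v _ ->]|[v ->]]; first by exists v; rewrite lfunE/= deriveE.
by apply/memv_imgP; exists v; [exact: memvf|rewrite lfunE/= deriveE].
Qed.

(** Two charts at the identity differ by a differentiable change of
    parameter, so [c0] alone already yields all tangent vectors. *)
Lemma orbit_tangentE p :
  orbit_tangent A p = [set u | u \in orbit_tangent_space p].
Proof.
apply/seteqP; split=> u /=.
  move=> [c [x [v [Ac dx cx ->]]]]; apply/mem_orbit_tangent_space.
  have [|t [dt tx near_t]] := transition Ac A0 dx d0; first by rewrite cx c01.
  exists ('D_v t x).
  have dm : differentiable (orbit_map p) (t x).
    by rewrite tx; exact: orbit_map_differentiable.
  have near_m : \forall y \near x, orbit_map p (t y) = act (c y) p.
    by apply: filterS near_t => y [_ ty]; rewrite /orbit_map ty.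
  rewrite -deriveE; last exact: orbit_map_differentiable.
  by rewrite (@derive_val _ _ _ _ _ _ _ (chain_is_derive v dt dm near_m)) tx.
move=> /mem_orbit_tangent_space[v ->]; exists c0, x0, v; split=> //.
by rewrite (deriveE _ (orbit_map_differentiable p A0 d0)).
Qed.

Hypothesis cohomA : cohomogeneity A 1.

(** Codimension at least one holds at every point because the orbit tangent
    space is always a linear subspace, as [orbit_codim] demands. *)
Lemma dim_orbit_tangent_space p : (\dim (orbit_tangent_space p) <= 1)%N.
Proof.
have dW : (\dim (orbit_tangent_space p) <= 2)%N.
  by apply: leq_trans (dimvS (subvf _)) _; rewrite dimvf.
have codimW : orbit_codim A p (2 - \dim (orbit_tangent_space p)).
  by exists (orbit_tangent_space p); [exact: orbit_tangentE|rewrite subnKC].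
have [_ /(_ _ _ codimW)] := cohomA.
by case: (\dim _) dW => [|[|[|]]].
Qed.

(** The velocities of v and w are parallel at every point of the plane, whose
    null coordinates are arbitrary. *)
Lemma tangent_minors v w : [/\ stretch' v * nullp' w = stretch' w * nullp' v,
  stretch' v * nullm' w = stretch' w * nullm' v &
  nullp' v * nullm' w = nullp' w * nullm' v].
Proof.
have minor a b : (stretch' v * a + nullp' v) * (- stretch' w * b + nullm' w) =
    (stretch' w * a + nullp' w) * (- stretch' v * b + nullm' v).
  have [p [pa pb]] := null_surj a b.
  have [pv nv] := orbit_velocity p v; have [pw nw] := orbit_velocity p w.
  rewrite -pa -pb -pv -nv -pw -nw.
  apply: (dim_le1_minor (dim_orbit_tangent_space p));
    apply/mem_orbit_tangent_space; first by exists v.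
  by exists w.
exact: affine_minors minor.
Qed.

Lemma tangent_neq0 :
  exists v, ~ [/\ stretch' v = 0, nullp' v = 0 & nullm' v = 0].
Proof.
have [[p [W WE]]] := cohomA.
rewrite addn1 => -[dW] _.
have uW : vpick W \in W by exact: memv_pick.
have u0 : vpick W != 0 by rewrite vpick0 -dimv_eq0 dW.
have : orbit_tangent A p (vpick W) by rewrite WE.
rewrite orbit_tangentE => /mem_orbit_tangent_space[v uE].
exists v => -[r0 p0 n0].
have [up un] := orbit_velocity p v.
move/eqP: u0; apply; rewrite uE; apply: null_inj.
  by rewrite up r0 p0 nullp0; ring.
by rewrite un r0 n0 nullm0; ring.
Qed.


(** Level sets of a locally constant function are open with open complement. *)
Lemma lie_connected_const (f : 'M[R]_2 * 'cV[R]_2 -> R) :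
  (forall c x, A c -> dom c x -> differentiable (fun y => f (c y)) x /\
    forall v, 'D_v (fun y => f (c y)) x = 0) ->
  forall g, H g -> f g = f (isom_one R).
Proof.
move=> df.
have [H1 _ _] := lie_group lieH.
suff BH : H `&` [set g | f g = f (isom_one R)] = H.
  by move=> g; rewrite -BH => -[].
have locconst c x : A c -> dom c x ->
    \forall y \near x, dom c y /\ f (c y) = f (c x).
  move=> Ac dx; apply: filterI (near_dom Ac dx) _.
  apply: (near_const (lie_open_dom lieH Ac) dx (f := fun y => f (c y))) => y.
  exact: df.
apply: connH.
- by move=> g [].
- by exists (isom_one R).
- move=> c Ac; rewrite openE => x [dx [_ fx]].
  apply: filterS (locconst c x Ac dx) => y [dy fy].
  by split=> //; split; [exact: chart_mem|rewrite /= fy].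
- move=> c Ac; rewrite openE => x [dx [Hx fx]].
  apply: filterS (locconst c x Ac dx) => y [dy fy].
  split=> //; split; first exact: chart_mem.
  by move=> [_ /= fy1]; apply: fx; split=> //=; rewrite -fy.
Qed.

(** If a positive value r were omitted, the sets f < r and f > r would
    disconnect H unless f < r throughout; but multiples of a
    positive value of f exceed r. *)
Lemma hom_surjective (f : 'M[R]_2 * 'cV[R]_2 -> R) :
  (forall g h, H g -> H h -> f (isom_mul g h) = f g + f h) ->
  (forall c x, A c -> dom c x -> {for x, continuous (fun y => f (c y))}) ->
  (exists2 g, H g & f g != 0) ->
  forall r, exists2 h, H h & f h = r.
Proof.
move=> fM fc [g0 Hg0 fg0].
have [H1 HM HV] := lie_group lieH.
have f1 : f (isom_one R) = 0.
  have := fM _ _ H1 H1; rewrite isom_mul1 => /eqP.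
  by rewrite -subr_eq subrr => /eqP.
have fV g : H g -> f (isom_inv g) = - f g.
  move=> Hg; apply/eqP; rewrite -addr_eq0 addrC -fM//; last exact: HV.
  by rewrite isom_mulV ?f1//; exact: mem_unitmx.
have [g Hg fg] : exists2 g, H g & 0 < f g.
  have [fg_lt0|fg_gt0|fg_eq0] := ltgtP (f g0) 0; last first.
  - by rewrite fg_eq0 eqxx in fg0.
  - by exists g0.
  by exists (isom_inv g0); [exact: HV|rewrite fV// oppr_gt0].
have pow n : exists2 h, H h & f h = f g *+ n.
  elim: n => [|n [h Hh fh]]; first by exists (isom_one R).
  by exists (isom_mul g h); [exact: HM|rewrite fM// fh mulrS].
have pos r : 0 < r -> exists2 h, H h & f h = r.
  move=> r0; apply: contrapT => no_r.
  have ne_r h : H h -> f h != r.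
    by move=> Hh; apply/eqP => fh; apply: no_r; exists h.
  have BH : H `&` [set h | f h < r] = H.
    apply: connH.
    - by move=> h [].
    - by exists (isom_one R); split=> //=; rewrite f1.
    - move=> c Ac; rewrite openE => x [dx [_ fx]].
      have near_lt : \forall y \near x, f (c y) < r.
        exact: (fc c x Ac dx _ (open_nbhs_nbhs (conj (@open_lt R r) fx))).
      apply: filterS2 near_lt (near_dom Ac dx) => y fy dy.
      by split=> //; split=> //; exact: chart_mem.
    - move=> c Ac; rewrite openE => x [dx [Hx fx]].
      have {}fx : r < f (c x).
        by rewrite lt_neqAle eq_sym ne_r// leNgt; apply/negP => lt; apply: fx.
      have near_gt : \forall y \near x, r < f (c y).
        exact: (fc c x Ac dx _ (open_nbhs_nbhs (conj (@open_gt R r) fx))).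
      apply: filterS2 near_gt (near_dom Ac dx) => y fy dy.
      split=> //; split; first exact: chart_mem.
      by move=> [_ /=]; rewrite ltNge (ltW fy).
  have [h Hh fh] := pow (Num.bound (r / f g)).
  have : (H `&` [set h | f h < r]) h by rewrite BH.
  move=> [_ /=]; rewrite fh ltNge; apply/negP/negPn/ltW.
  rewrite -mulr_natl -ltr_pdivrMr//; apply: archi_boundP.
  by rewrite divr_ge0// ltW.
move=> r; have [r_lt0|r_gt0|->] := ltgtP r 0.
- have [|h Hh fh] := pos (- r); first by rewrite oppr_gt0.
  by exists (isom_inv h); [exact: HV|rewrite fV// fh opprK].
- exact: pos.
- by exists (isom_one R).
Qed.


(** For the field (r P + m, - r Q + n) the group elements satisfy
    a = (s - 1) m / r, written without division so as to cover r = 0 too. *)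
Lemma first_integral_nullp v g : H g ->
  (stretch' v * nullp g.2 + nullp' v) * costretch g.1 = nullp' v.
Proof.
move=> Hg.
pose F (k : 'M[R]_2 * 'cV[R]_2) :=
  (stretch' v * nullp k.2 + nullp' v) * costretch k.1.
have F1 : F (isom_one R) = nullp' v.
  by rewrite /F nullp0 /costretch !mxE /=; ring.
rewrite -[RHS]F1 -/(F g).
apply: (lie_connected_const (f := F)) => // c x Ac dx; split.
  apply: (chart_coord_differentiable (f := F)) => // k.
  exact: (differentiableM (differentiableD (differentiableM
    (differentiable_cst (stretch' v) k) (differentiable_nullp k))
    (differentiable_cst (nullp' v) k)) (differentiable_costretch k)).
move=> u; have [w [_ Dc Dp _]] := right_invariance u Ac dx.
have D := is_derive_affineM (stretch' v) (nullp' v)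
  (chart_coord_is_derive u (@differentiable_nullp R) Ac dx)
  (chart_coord_is_derive u (@differentiable_costretch R) Ac dx).
rewrite /F (@derive_val _ _ _ _ _ _ _ D) Dc Dp.
have [m _ _] := tangent_minors v w.
transitivity
  ((stretch' v * nullp' w - stretch' w * nullp' v) * costretch (c x).1).
  by ring.
by rewrite m subrr mul0r.
Qed.

Lemma first_integral_nullm v g : H g ->
  (stretch' v * nullm g.2 + - nullm' v) * stretch g.1 = - nullm' v.
Proof.
move=> Hg.
pose F (k : 'M[R]_2 * 'cV[R]_2) :=
  (stretch' v * nullm k.2 + - nullm' v) * stretch k.1.
have F1 : F (isom_one R) = - nullm' v.
  by rewrite /F nullm0 /stretch !mxE /=; ring.
rewrite -[RHS]F1 -/(F g).
apply: (lie_connected_const (f := F)) => // c x Ac dx; split.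
  apply: (chart_coord_differentiable (f := F)) => // k.
  exact: (differentiableM (differentiableD (differentiableM
    (differentiable_cst (stretch' v) k) (differentiable_nullm k))
    (differentiable_cst (- nullm' v) k)) (differentiable_stretch k)).
move=> u; have [w [Dr _ _ Dn]] := right_invariance u Ac dx.
have D := is_derive_affineM (stretch' v) (- nullm' v)
  (chart_coord_is_derive u (@differentiable_nullm R) Ac dx)
  (chart_coord_is_derive u (@differentiable_stretch R) Ac dx).
rewrite /F (@derive_val _ _ _ _ _ _ _ D) Dr Dn.
have [_ m _] := tangent_minors v w.
transitivity
  ((stretch' v * nullm' w - stretch' w * nullm' v) * stretch (c x).1).
  by ring.
by rewrite m subrr mul0r.
Qed.

(** The field (r P + m, - r Q + n) vanishes at the point q = (- m / r, n / r),
    and the first integrals say that H fixes q. Surjectivity of log s then gives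
    all boosts around q. *)
Lemma boost_group_of_stretch'_neq0 v : stretch' v != 0 ->
  exists q, H = [set g | SO11o g.1 /\ g.2 = q - g.1 *m q].
Proof.
move=> r0.
have [q [qp qn]] :=
  null_surj (- (nullp' v / stretch' v)) (nullm' v / stretch' v).
have fixq g : H g -> g.2 = q - g.1 *m q.
  move=> Hg; have bg := mem_boost_mx Hg; have [_ _ rg0 rc] := bg.
  have Fp := first_integral_nullp v Hg; have Fn := first_integral_nullm v Hg.
  have npE : nullp (- (g.1 *m q)) = - (stretch g.1 * nullp q).
    by rewrite -scaleN1r nullpZ nullp_mul// mulN1r.
  have nnE : nullm (- (g.1 *m q)) = - (costretch g.1 * nullm q).
    by rewrite -scaleN1r nullmZ nullm_mul// mulN1r.
  apply: null_inj.
    rewrite nullpD npE qp; apply: (mulfI r0).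
    transitivity ((stretch' v * nullp g.2 + nullp' v) * costretch g.1 *
      stretch g.1 - nullp' v).
      by rewrite -[_ * costretch g.1 * stretch g.1]mulrA
        [costretch g.1 * _]mulrC rc; ring.
    by rewrite Fp; field.
  rewrite nullmD nnE qn; apply: (mulfI r0).
  transitivity ((stretch' v * nullm g.2 + - nullm' v) * stretch g.1 *
    costretch g.1 + nullm' v).
    rewrite -[_ * stretch g.1 * costretch g.1]mulrA rc; ring.
  by rewrite Fn; field.
exists q; apply/seteqP; split=> [g Hg|[x u] /= [Cx ->]].
  by split; [exact: HG|exact: fixq].
have bx := SO11o_boost_mx Cx; have [_ _ rx0 _] := bx.
have [||| h Hh fh] :=
  @hom_surjective (fun g => ln (stretch g.1)) _ _ _ (ln (stretch x)).
- move=> g h Hg Hh.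
  have [_ _ rg0 _] := mem_boost_mx Hg; have [_ _ rh0 _] := mem_boost_mx Hh.
  by rewrite /= stretchM ?lnM ?posrE//; exact: mem_boost_mx.
- move=> c y Ac dy.
  have [_ _ ry0 _] := mem_boost_mx (chart_mem Ac dy).
  have cr : {for y, continuous (fun y => stretch (c y).1)}.
    apply: differentiable_continuous.
    exact: (chart_coord_differentiable (@differentiable_stretch R) Ac dy).
  exact: (continuous_comp cr (continuous_ln ry0)).
- apply: contrapT => no_g.
  have stretch1 g : H g -> stretch g.1 = 1.
    move=> Hg; have [_ _ rg0 _] := mem_boost_mx Hg.
    apply: ln_inj; rewrite ?posrE ?ltr01// ln1; apply/eqP/negPn/negP => lg.
    by apply: no_g; exists g.
  move/eqP: r0; apply; rewrite /stretch' -[RHS](derive_cst (1 : R) x0 v).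
  apply: near_eq_derive; apply: filterS (near_dom A0 d0) => y dy.
  by rewrite stretch1//; exact: chart_mem.
have bh := mem_boost_mx Hh; have [_ _ rh0 _] := bh.
have <- : h = (x, q - x *m q); last by [].
have hx : h.1 = x by apply: boost_mx_inj => //; apply: ln_inj; rewrite ?posrE.
by rewrite [h]surjective_pairing (fixq h Hh) hx.
Qed.

(** For r = 0 the first integrals force s = 1, so H consists of translations,
    and they preserve n P - m Q, that is, they go along w = (m, n). *)
Lemma translation_group_of_stretch'_eq0 v : stretch' v = 0 ->
  ~ (nullp' v = 0 /\ nullm' v = 0) ->
  exists2 w, w != 0 & H = translation_line w.
Proof.
move=> r0 v0.
have [w [wp wn]] := null_surj (nullp' v) (nullm' v).
have w0 : w != 0.
  by apply/eqP => w0; apply: v0; rewrite -wp -wn w0 nullp0 nullm0.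
have lin1 g : H g -> g.1 = 1%:M.
  move=> Hg; have bg := mem_boost_mx Hg; have [_ _ rg0 rc] := bg.
  have Fp := first_integral_nullp v Hg; have Fn := first_integral_nullm v Hg.
  apply: boost_mx_eq1 => //; have [p0|p0] := eqVneq (nullp' v) 0.
    have n0 : - nullm' v != 0 by rewrite oppr_eq0; apply/eqP => n0; apply: v0.
    by apply: (mulfI n0); rewrite mulr1 -[RHS]Fn r0; ring.
  have c1 : costretch g.1 = 1.
    by apply: (mulfI p0); rewrite mulr1 -[RHS]Fp r0; ring.
  by rewrite -rc c1 mulr1.
have r0' u : stretch' u = 0.
  have [mp mn _] := tangent_minors v u; rewrite r0 !mul0r in mp mn.
  apply/eqP/negPn/negP => ru; apply: v0.
  by split; apply: (mulfI ru); rewrite mulr0.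
(* In null coordinates w is (nullp' v, nullm' v), of square length N; the
   parameter t below is the scalar product with w divided by N. *)
pose N := nullp' v ^+ 2 + nullm' v ^+ 2.
have N0 : N != 0.
  apply/eqP => /eqP; rewrite paddr_eq0 ?sqr_ge0// !sqrf_eq0.
  by move=> /andP[/eqP ? /eqP ?]; apply: v0.
have collinear g : H g -> nullm' v * nullp g.2 = nullp' v * nullm g.2.
  move=> Hg; apply/eqP; rewrite -subr_eq0; apply/eqP.
  pose F (k : 'M[R]_2 * 'cV[R]_2) :=
    nullm' v * nullp k.2 + - nullp' v * nullm k.2.
  have F1 : F (isom_one R) = 0 by rewrite /F nullp0 nullm0; ring.
  rewrite -[RHS]F1 -mulNr -/(F g).
  apply: (lie_connected_const (f := F)) => // c x Ac dx; split.
    apply: (chart_coord_differentiable (f := F)) => // k.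
    exact: (differentiableD
      (differentiableM (differentiable_cst (nullm' v) k)
        (differentiable_nullp k))
      (differentiableM (differentiable_cst (- nullp' v) k)
        (differentiable_nullm k))).
  move=> u; have [y [_ _ Dp Dn]] := right_invariance u Ac dx.
  have D := is_deriveD
    (is_deriveM (is_derive_cst (nullm' v) x u)
      (chart_coord_is_derive u (@differentiable_nullp R) Ac dx))
    (is_deriveM (is_derive_cst (- nullp' v) x u)
      (chart_coord_is_derive u (@differentiable_nullm R) Ac dx)).
  have [_ _ m] := tangent_minors v y.
  rewrite (@derive_val _ _ _ _ _ _ _ D) Dp Dn r0' !scaler0 /GRing.scale /=.
  by rewrite oppr0 !mul0r !add0r !addr0 mulNr m; ring.
pose t (g : 'M[R]_2 * 'cV[R]_2) :=
  nullp' v / N * nullp g.2 + nullm' v / N * nullm g.2.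
have transE g : H g -> g.2 = t g *: w.
  move=> Hg; have cg := collinear g Hg.
  apply: null_inj; rewrite ?nullpZ ?nullmZ ?wp ?wn; apply: (mulfI N0).
    transitivity (nullp' v * (nullp' v * nullp g.2 + nullm' v * nullm g.2)).
      rewrite [RHS]mulrDr [nullp' v * (nullm' v * _)]mulrCA -cg /N; ring.
    by rewrite /t; field.
  transitivity (nullm' v * (nullp' v * nullp g.2 + nullm' v * nullm g.2)).
    rewrite [RHS]mulrDr [nullm' v * (nullp' v * _)]mulrCA cg /N; ring.
  by rewrite /t; field.
exists w => //; apply/seteqP; split=> [g Hg|_ /= [r ->]].
  by exists (t g); rewrite [LHS]surjective_pairing lin1// -transE.
have [||| h Hh fh] := @hom_surjective t _ _ _ r.
- by move=> g h Hg Hh; rewrite /t /= lin1// mul1mx nullpD nullmD; ring.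
- move=> c x Ac dx; apply: differentiable_continuous.
  apply: (chart_coord_differentiable (f := t)) => // k.
  exact: (differentiableD
    (differentiableM (differentiable_cst (nullp' v / N) k)
        (differentiable_nullp k))
    (differentiableM (differentiable_cst (nullm' v / N) k)
        (differentiable_nullm k))).
- apply: contrapT => no_g.
  have trans0 g : H g -> g.2 = 0.
    move=> Hg; rewrite transE//; have [->|tg] := eqVneq (t g) 0.
      by rewrite scale0r.
    by exfalso; apply: no_g; exists g.
  apply: v0; split.
    rewrite /nullp' -[RHS](derive_cst (0 : R) x0 v); apply: near_eq_derive.
    apply: filterS (near_dom A0 d0) => y dy.
    by rewrite trans0 ?nullp0//; exact: chart_mem.
  rewrite /nullm' -[RHS](derive_cst (0 : R) x0 v); apply: near_eq_derive.
  apply: filterS (near_dom A0 d0) => y dy.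
  by rewrite trans0 ?nullm0//; exact: chart_mem.
have <- : h = (1%:M, r *: w); last by [].
by rewrite -fh -transE// -(lin1 h Hh); case: h {fh Hh}.
Qed.

Lemma line_or_boosts :
  (exists2 w, w != 0 & H = translation_line w) \/
  (exists q, H = [set g | SO11o g.1 /\ g.2 = q - g.1 *m q]).
Proof.
have [v v0] := tangent_neq0; have [r0|r0] := eqVneq (stretch' v) 0.
  left; apply: (translation_group_of_stretch'_eq0 r0) => -[p0 n0].
  exact: v0.
by right; exact: (boost_group_of_stretch'_neq0 r0).
Qed.

End LieSubgroups.

(** * Orbit equivalence with the standard actions *)

Section OrbitEquivalence.
Set Implicit Arguments.
Unset Strict Implicit.
Context {R : realType}.
Implicit Types (m : 'M[R]_2) (w p q : 'cV[R]_2).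

Lemma act_surj f p : @isomL2 R f -> exists q, act f q = p.
Proof.
move=> /O11_unitmx fu; exists (invmx f.1 *m (p - f.2)).
by rewrite /act mulKVmx// subrK.
Qed.

(** Orbits of H are mapped onto orbits of K as soon as f intertwines the orbit
    through p with the orbit through f p, isometries being surjective. *)
Lemma orbit_equivalent_of (H K : set ('M[R]_2 * 'cV[R]_2)) f : isomL2 f ->
  (forall p, [set act f q | q in orbit_of H p] = orbit_of K (act f p)) ->
  orbit_equivalent H K.
Proof.
move=> fO fHK; exists f => //; apply/seteqP; split=> O.
  by move=> [_ [p _ <-] <-]; exists (act f p).
move=> [p _ <-]; have [q <-] := act_surj p fO.
by exists (orbit_of H q); [exists q|].
Qed.

Lemma translation_line_scale k w : k != 0 ->
  translation_line (k *: w) = translation_line w.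
Proof.
move=> k0; apply/seteqP; split=> g [t ->] /=.
  by exists (t * k); rewrite scalerA.
by exists (t / k); rewrite scalerA divfK.
Qed.

Lemma translation_line_equivalent m w : O11 m ->
  orbit_equivalent (translation_line w) (translation_line (m *m w)).
Proof.
move=> mO; apply: (@orbit_equivalent_of _ _ (m, 0)) => // p.
apply/seteqP; split=> z /=.
  move=> [q [g [s gE] gq] fq]; exists (1%:M, s *: (m *m w)); first by exists s.
  by rewrite -fq -gq gE /act /= !mul1mx !addr0 mulmxDr scalemxAr.
move=> [g [s gE] fg]; exists (act (1%:M, s *: w) p).
  by exists (1%:M, s *: w) => //; exists s.
by rewrite -fg gE /act /= !mul1mx !addr0 mulmxDr scalemxAr.
Qed.

Lemma translation_line_equivalent_scale m w k u : O11 m -> k != 0 ->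
  m *m w = k *: u ->
  orbit_equivalent (translation_line w) (translation_line u).
Proof.
move=> mO k0 mw; rewrite -(translation_line_scale u k0) -mw.
exact: translation_line_equivalent.
Qed.

Lemma O11_hyperbolic (a b : R) : a ^+ 2 - b ^+ 2 = 1 ->
  O11 (\matrix_(i < 2, j < 2) (if i == j then a else b)).
Proof. by move=> ab; apply/O11P; split; rewrite !mxE /=; lra. Qed.

Lemma O11_reflection :
  O11 (\matrix_(i < 2, j < 2) (if i == j then (-1) ^+ i else 0 : R)).
Proof. by apply/O11P; split; rewrite !mxE /=; lra. Qed.

(** The matrices are, up to scale, the hyperbolic rotations with first or second
    row proportional to the covector (w0, - w1), which send w to an axis.
    Null vectors lie on one of two lines, exchanged by a reflection. *)
Lemma translation_line_classification w : w != 0 ->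
  [\/ orbit_equivalent (translation_line w) (translation_line (e1 R)),
      orbit_equivalent (translation_line w) (translation_line (e2 R)) |
      orbit_equivalent (translation_line w) (translation_line (e1 R - e2 R))].
Proof.
move=> w0; pose n := w 0 0 ^+ 2 - w 1 0 ^+ 2.
have [n_lt0|n_gt0|n_eq0] := ltgtP n 0.
- pose s := Num.sqrt (- n).
  have s0 : s != 0 by rewrite sqrtr_eq0 -ltNge oppr_gt0.
  have s2 : s ^+ 2 = - n by rewrite sqr_sqrtr// oppr_ge0 ltW.
  constructor 2; apply: (translation_line_equivalent_scale
    (O11_hyperbolic (a := w 1 0 / s) (b := - (w 0 0 / s)) _) s0).
    rewrite sqrrN !expr_div_n -mulrBl s2 /n opprB divff//.
    by rewrite -[X in X != 0]opprB oppr_eq0 lt_eqF.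
  apply: cV2P; rewrite mulmx2E /e2 !mxE /= ?mulr0 ?mulr1; first by field.
  apply: (mulfI s0); rewrite -[RHS]expr2 s2 /n; by field.
- pose s := Num.sqrt n.
  have s0 : s != 0 by rewrite sqrtr_eq0 -ltNge.
  have s2 : s ^+ 2 = n by rewrite sqr_sqrtr// ltW.
  constructor 1; apply: (translation_line_equivalent_scale
    (O11_hyperbolic (a := w 0 0 / s) (b := - (w 1 0 / s)) _) s0).
    by rewrite sqrrN !expr_div_n -mulrBl s2 /n divff// gt_eqF.
  apply: cV2P; rewrite mulmx2E /e1 !mxE /= ?mulr0 ?mulr1; last by field.
  apply: (mulfI s0); rewrite -[RHS]expr2 s2 /n; by field.
- have w00 : w 0 0 != 0.
    apply: contra_neq w0 => w00; apply: cV2P; rewrite !mxE//.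
    apply/eqP; rewrite -sqrf_eq0; apply/eqP.
    by move: n_eq0; rewrite /n w00 => h; lra.
  constructor 3; move/eqP: n_eq0; rewrite subr_eq0 eqf_sqr => /orP[]/eqP w01.
    apply: (translation_line_equivalent_scale O11_reflection w00).
    by apply: cV2P; rewrite mulmx2E /e1 /e2 !mxE /= w01; ring.
  have O1 : O11 (1%:M : 'M[R]_2) by move=> u v; rewrite !mul1mx.
  apply: (translation_line_equivalent_scale O1 w00).
  by rewrite mul1mx; apply: cV2P; rewrite /e1 /e2 !mxE /= w01; ring.
Qed.

(** The translation by - q conjugates boosts around q to boosts around 0. *)
Lemma conjugate_boosts_equivalent q :
  orbit_equivalent [set g | SO11o g.1 /\ g.2 = q - g.1 *m q] (@boosts R).
Proof.
have O1 : O11 (1%:M : 'M[R]_2) by move=> u v; rewrite !mul1mx.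
apply: (@orbit_equivalent_of _ _ (1%:M, - q)) => // p.
apply/seteqP; split=> z /=.
  move=> [_ [[x u] /= [Cx ->] <-] <-]; exists (x, 0) => //.
  by rewrite /act /= !mul1mx addr0 mulmxBr [q - _]addrC addrA addrK.
move=> [[x _] [/= Cx ->] <-]; exists (act (x, q - x *m q) p).
  by exists (x, q - x *m q).
by rewrite /act /= !mul1mx addr0 mulmxBr [q - _]addrC addrA addrK.
Qed.

End OrbitEquivalence.

Theorem theorem5p1 (R : realType) (d : nat)
    (H : set ('M[R]_2 * 'cV[R]_2)) (A : set (param R d)) :
  lie_subgroup H A -> lie_connected H A ->
  H `<=` @isomL2o R ->
  cohomogeneity A 1 ->
  [\/ orbit_equivalent H (translation_line (e1 R)),
      orbit_equivalent H (translation_line (e2 R)),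
      orbit_equivalent H (translation_line (e1 R - e2 R)) |
      orbit_equivalent H (@boosts R)].
Proof.
move=> lieH connH HG cohomA.
have [H1 _ _] := lie_group lieH.
have [c0 [x0 [A0 d0 c01]]] := chart_at lieH H1.
have [[w w0 ->]|[q ->]] := line_or_boosts lieH connH HG A0 d0 c01 cohomA.
  by case: (translation_line_classification w0) => ?;
    [constructor 1|constructor 2|constructor 3].
by constructor 4; exact: conjugate_boosts_equivalent.
Qed.
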